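(* Let $(a_n,b_n)$, $n\ge1$, be the $P$-positions $(x,y)$ with $0<x\le y$ of Corner the 2-Queen Dee, listed so that $a_1<a_2<\cdots$. Let $\mathbf t=\lim_{m\to\infty}\tau^m(a)$ be the Tribonacci word, the fixed point of the morphism $\tau(a)=ab$, $\tau(b)=ac$, $\tau(c)=a$, and let $\mathbf t_b$ be the infinite word obtained from $\mathbf t$ by deleting all occurrences of the letter $b$. Index the letters of $\mathbf t_b$ by $1,2,3,\ldots$. Then for every $n\ge1$, $a_n$ is the position of the $n$-th occurrence of $a$ in $\mathbf t_b$, and $b_n$ is the position of the $n$-th occurrence of $c$ in $\mathbf t_b$.
   Context: Positions are pairs $(x,y)$ of nonnegative integers. From $(x,y)$ the 2-Queen Dee may move to any position different from $(x,y)$ among: (i) $(x',y)$ with $0\le x'<x$, or $(x,y')$ with $0\le y'<y$; (ii) for each starting point $(u,v)\in\{(x,y),(x-1,y),(x,y-1)\}$ with $u,v\ge0$: the positions $(u-s,v-s)$ with $0\le s\le\min(u,v)$, and, if $u<v$, the positions $(t,v-u-t)$ with $0<t\le v-u$, and, if $u>v$, the positions $(u-v-t,t)$ with $0<t\le u-v$. Every move strictly decreases $x+y$. $P$-positions: $(0,0)$ is a $P$-position, and a position is a $P$-position iff it has no move to a $P$-position. *)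

(* Defs.v *)
From HB Require Import structures.
From mathcomp Require Import all_boot.
From mathcomp Require Import zify.

Set Implicit Arguments.
Unset Strict Implicit.
Unset Printing Implicit Defensive.

Definition position := (nat * nat)%type.

Definition dee_start (x y u v : nat) : Prop :=
  [\/ (u, v) = (x, y),
      0 < x /\ (u, v) = (x.-1, y)
    | 0 < y /\ (u, v) = (x, y.-1)].

Definition dee_slide (u v : nat) (q : position) : Prop :=
  [\/ exists2 s, s <= minn u v & q = (u - s, v - s),
      u < v /\ (exists2 t, 0 < t <= v - u & q = (t, v - u - t))
    | v < u /\ (exists2 t, 0 < t <= u - v & q = (u - v - t, t))].

Definition dee_move (p q : position) : Prop :=
  let: (x, y) := p in
  q <> p /\
  [\/ exists2 x', x' < x & q = (x', y),
      exists2 y', y' < y & q = (x, y')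
    | exists u v, dee_start x y u v /\ dee_slide u v q].

(* On the axes a slide can preserve x + y, e.g. (0,3) -> (3,0) -> (0,3), so
   well-foundedness fails there. The condition below still has exactly one
   solution (P_positions_exist, P_positions_unique), because every nonzero
   axis position has a move to (0,0). *)
Definition P_positions (P : position -> Prop) : Prop :=
  P (0, 0) /\ forall p, P p <-> ~ exists2 q, dee_move p q & P q.

(* The sequences are indexed from 1; a 0 and b 0 are irrelevant. *)
Definition lists_P (P : position -> Prop) (a b : nat -> nat) : Prop :=
  (forall n, 0 < n -> a n < a n.+1) /\
  forall x y, (0 < x <= y /\ P (x, y)) <->
              exists2 n, 0 < n & (x, y) = (a n, b n).

Variant letter := La | Lb | Lc.

Definition letter_eq_dec (x y : letter) : {x = y} + {x <> y}.
Proof. decide equality. Defined.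

HB.instance Definition _ := hasDecEq.Build letter (compareP letter_eq_dec).

Definition tau (x : letter) : seq letter :=
  match x with
  | La => [:: La; Lb]
  | Lb => [:: La; Lc]
  | Lc => [:: La]
  end.

Definition tau_word (s : seq letter) : seq letter := flatten (map tau s).

(* Infinite words are functions on nat, the first letter being w 0. *)
Definition word_limit (T : Type) (w : nat -> seq T) (t : nat -> T) : Prop :=
  forall i, exists M, forall m, M <= m -> onth (w m) i = Some (t i).

Definition tribonacci_word (t : nat -> letter) : Prop :=
  word_limit (fun m => iter m tau_word [:: La]) t.

(* v is the infinite word obtained from w by deleting all letters x. *)
Definition deletion (T : Type) (x : T) (w v : nat -> T) : Prop :=
  exists f : nat -> nat,
    [/\ forall i, f i < f i.+1,
        forall j, w j <> x <-> exists i, f i = j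
      & forall i, v i = w (f i)].

(* Positions are counted from 1, hence p.-1. *)
Definition nth_occurrence (T : eqType) (w : nat -> T) (x : T) (n p : nat) :=
  [&& 0 < p, w p.-1 == x & count_mem x (mkseq w p) == n].

Lemma dee_move_decr x y q :
  0 < x -> 0 < y -> dee_move (x, y) q -> q.1 + q.2 < x + y.
Proof.
move=> x0 y0 [/eqP ne [[x' h ->]|[y' h ->]|[u [v [st sl]]]]] /=; try lia.
have uv : u + v <= x + y by case: st => [[-> ->]|[_ [-> ->]]|[_ [-> ->]]]; lia.
have uv' : u + v = x + y -> (u, v) = (x, y).
  by case: st => [//|[_ [-> ->]]|[_ [-> ->]]]; lia.
case: sl => [[s hs qE]|[h [s hs qE]]|[h [s hs qE]]]; subst q => /=.
- case: (posnP s) => [s0|]; last by lia.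
  subst s; rewrite !subn0 in ne *.
  have := uv; rewrite leq_eqVlt => /orP[/eqP e|//].
  by rewrite uv' ?eqxx in ne.
- case: (posnP u) => [u0|]; last by lia.
  have := uv; rewrite leq_eqVlt => /orP[/eqP/uv' [e1 e2]|]; lia.
- case: (posnP v) => [v0|]; last by lia.
  have := uv; rewrite leq_eqVlt => /orP[/eqP/uv' [e1 e2]|]; lia.
Qed.

Lemma dee_move_axis x y :
  x = 0 \/ y = 0 -> (x, y) <> (0, 0) -> dee_move (x, y) (0, 0).
Proof.
move=> h ne; split; first by move=> e; apply: ne.
case: h ne => -> ne.
- by apply: Or32; exists 0 => //; case: y ne.
- by apply: Or31; exists 0 => //; case: x ne.
Qed.

Lemma dee_no_move q : ~ dee_move (0, 0) q.
Proof.
move=> [ne [[x' //]|[y' //]|[u [v [st sl]]]]].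
case: st sl => [[-> ->]|[//]|[//]] [[s hs qE]|[//]|[//]].
by apply: ne; rewrite qE.
Qed.

Lemma P_positions_exist : exists P, P_positions P.
Proof.
pose fix W (k : nat) (p : position) {struct k} : Prop :=
  if k is k'.+1 then p = (0, 0) \/
    (0 < p.1 /\ 0 < p.2 /\ ~ exists2 q, dee_move p q & W k' q)
  else False.
have Wst N : forall p, p.1 + p.2 < N ->
    forall k k', p.1 + p.2 < k -> p.1 + p.2 < k' -> W k p -> W k' p.
  elim: N => // N IH [x y] hN [|k] //= [|k'] //= hk hk'.
  case=> [->|[x0 [y0 H]]]; [by left|right; split=> //; split=> //].
  move=> [q mq Wq]; apply: H; exists q => //.
  have d := dee_move_decr x0 y0 mq; simpl in *.
  by apply: (IH q _ k') => //; lia.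
exists (fun p => W (p.1 + p.2).+1 p); split; first by left.
move=> [x y]; split.
- move=> /= [[-> ->] [q /dee_no_move]//|[x0 [y0 H]] [q mq Wq]].
  have d := dee_move_decr x0 y0 mq.
  by apply: H; exists q => //; apply: (Wst _ q (ltnSn _) (q.1 + q.2).+1 (x + y) _ _ Wq); lia.
- move=> H /=.
  case: (eqVneq (x, y) (0, 0)) => [|/eqP ne]; [by left|right].
  have ax : ~ (x = 0 \/ y = 0).
    by move=> /dee_move_axis /(_ ne) m; apply: H; exists (0, 0) => //=; left.
  have x0 : 0 < x by case: (x) ax => // [] []; left.
  have y0 : 0 < y by case: (y) ax => // [] []; right.
  split=> //; split=> // -[q mq Wq]; apply: H; exists q => //.
  have d := dee_move_decr x0 y0 mq.
  by apply: (Wst _ q (ltnSn _) (x + y) (q.1 + q.2).+1 _ _ Wq); lia.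
Qed.

Lemma P_positions_unique P Q :
  P_positions P -> P_positions Q -> forall p, P p <-> Q p.
Proof.
suff H P' Q' : P_positions P' -> P_positions Q' -> forall n p,
    p.1 + p.2 < n -> (P' p -> Q' p) /\ (Q' p -> P' p).
  move=> hP hQ p; exact: (H P Q hP hQ (p.1 + p.2).+1).
move=> [P0 HP] [Q0 HQ]; elim=> // n IH [x y] /= hn.
case: (eqVneq (x, y) (0, 0)) => [->//|/eqP ne].
have ax R : R (0, 0) -> (forall p, R p <-> ~ exists2 q, dee_move p q & R q) ->
    x = 0 \/ y = 0 -> ~ R (x, y).
  move=> R0 HR h /HR; apply; exists (0, 0) => //; exact: dee_move_axis.
case: (posnP x) => [x0|x0].
  by split=> h; exfalso; [apply: (ax P')|apply: (ax Q')] => //; left.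
case: (posnP y) => [y0|y0].
  by split=> h; exfalso; [apply: (ax P')|apply: (ax Q')] => //; right.
have st q : dee_move (x, y) q -> (P' q -> Q' q) /\ (Q' q -> P' q).
  by move=> /(dee_move_decr x0 y0) d; apply: IH; lia.
split=> [/HP h|/HQ h].
- by apply/HQ => -[q mq Rq]; apply: h; exists q => //; apply: (st _ mq).2.
- by apply/HP => -[q mq Rq]; apply: h; exists q => //; apply: (st _ mq).1.
Qed.

Lemma deletion_exists (T : eqType) (x : T) (w : nat -> T) :
  (forall i, exists j, (i <= j) && (w j != x)) -> exists v, deletion x w v.
Proof.
move=> H; pose nx i := ex_minn (H i).
pose f := fix f k := if k is k'.+1 then nx (f k').+1 else nx 0.
have nxP i : [/\ i <= nx i, w (nx i) != x
               & forall j, i <= j -> w j != x -> nx i <= j].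
  rewrite /nx; case: ex_minnP => m /andP[h1 h2] h3; split=> // j ij wj.
  by apply: h3; rewrite ij.
exists (w \o f), f; split=> // [i|j]; first by case: (nxP (f i).+1).
split=> [/eqP wj|[[|i] <-] /=]; last 2 first.
- by apply/eqP; case: (nxP 0).
- by apply/eqP; case: (nxP (f i).+1).
suff S n : (exists i, f i = j) \/ f n <= j.
  case: (S j.+1) => // h; exfalso.
  have fge i : i <= f i.
    by elim: i => // i IH; case: (nxP (f i).+1) => h' _ _; apply: leq_ltn_trans h'.
  by have := leq_trans (fge j.+1) h; rewrite ltnn.
elim: n => [|n [|le]]; [|by left|].
  by right; case: (nxP 0) => _ _; apply.
case: (eqVneq (f n) j) => [|ne]; first by left; exists n.
by right; case: (nxP (f n).+1) => _ _; apply=> //; rewrite ltn_neqAle ne.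
Qed.

Lemma tribonacci_deletion_exists :
  exists t tb, tribonacci_word t /\ deletion Lb t tb.
Proof.
pose u m := iter m tau_word [:: La].
have uS m : u m.+1 = tau_word (u m) by [].
have tcat s1 s2 : tau_word (s1 ++ s2) = tau_word s1 ++ tau_word s2.
  by rewrite /tau_word map_cat flatten_cat.
have pre m k : exists s, u (m + k) = u m ++ s.
  have pS n : exists s, u n.+1 = u n ++ s.
    elim: n => [|n [s e]]; first by exists [:: Lb].
    by exists (tau_word s); rewrite uS {1}e tcat -uS.
  elim: k => [|k [s e]]; first by exists [::]; rewrite addn0 cats0.
  have [s' e'] := pS (m + k).
  by exists (s ++ s'); rewrite addnS e' e catA.
have szt s : size s <= size (tau_word s).
  elim: s => // x s IH; rewrite -cat1s tcat !size_cat.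
  by apply: leq_add => //; case: x.
have sz m : m < size (u m).
  elim: m => // m IH; apply: (leq_ltn_trans IH); rewrite uS.
  have [s e] := pre 0 m; rewrite add0n in e; rewrite e tcat !size_cat /=.
  by have := szt s; lia.
pose t i := nth La (u i) i.
have tE i m : i <= m -> i < size (u m) /\ nth La (u m) i = t i.
  move=> le; have [s] := pre i (m - i); rewrite subnKC // => ->.
  by rewrite size_cat nth_cat sz ltn_addr.
have lim : tribonacci_word t.
  move=> i; exists i => m le; have [h1 h2] := tE i m le.
  by rewrite onthE (nth_map La) // h2.
exists t.
have [|tb h] := @deletion_exists _ Lb t; last by exists tb.
pose e (x y : letter) := ~~ ((x == Lb) && (y == Lb)).
have pt s x : path e x (tau_word s).
  elim: s x => // y s IH x; rewrite -cat1s tcat cat_path IH andbT.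
  by case: x; case: y.
move=> i; case: (eqVneq (t i) Lb) => [ti|]; last by exists i; rewrite leqnn.
exists i.+1; rewrite leqnSn /=.
have := pt (u i) La; rewrite -uS => /pathP -/(_ La i.+1 (sz _)) /=.
have [_ ->] := tE i i.+1 (leqnSn _); have [_ ->] := tE i.+1 i.+1 (leqnn _).
by rewrite /e ti.
Qed.

(* Main.v *)
(* Number the letters of t from 0 and let alpha(n), beta(n) count the letters a, b
   among the first n. Since t = tau(t), the n-th a of t (n >= 0) is at place
   n + alpha(n) + beta(n), and following it through tau gives the n-th b and the
   n-th c. Hence in t_b, counting places from 1, the n-th a and c are at
     a_n = n + 1 + beta(n)  and  b_n = a_n + 2 e_n,  where e_n = n + 1 + alpha(n).
   Replacing in t every b by a block of two places, or else every a, shows that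
   both (a_n), (b_n) and (e_n), (a_n + e_n) are complementary. The first fact
   controls the rook moves. The pair (a_n, b_n) has difference 2 e_n and sum
   2 (a_n + e_n), so by the second fact the positive even numbers are partitioned
   into differences and sums. This controls the slides, which from (x,y), x <= y,
   reach the positions of difference d (down the diagonal) or of sum |d| with
   |d - (y - x)| <= 1. *)
Require Import Defs.
From mathcomp Require Import all_boot.
From mathcomp Require Import zify.

Set Implicit Arguments.
Unset Strict Implicit.
Unset Printing Implicit Defensive.

(** * Strictly increasing sequences and complementary pairs *)

Lemma ltn_incr (f : nat -> nat) :
  (forall i, f i < f i.+1) -> {mono f : i j / i < j}.
Proof.
move=> fS; apply: leqW_mono; apply: leq_mono => i j.
exact: (homo_ltn ltn_trans).
Qed.

Lemma incr_inj (f : nat -> nat) : (forall i, f i < f i.+1) -> injective f.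
Proof.
move=> /ltn_incr fm i j e.
by have := fm i j; have := fm j i; rewrite e ltnn; case: ltngtP.
Qed.

(** By strong induction, [f n = g j] forces [n <= j], since the earlier values of [g] are already
    taken by [f]. Hence [g n <= f n], and symmetrically. *)
Lemma incr_same_range_eq (f g : nat -> nat) :
  (forall i, f i < f i.+1) -> (forall i, g i < g i.+1) ->
  (forall i, exists j, f i = g j) -> (forall i, exists j, g i = f j) ->
  f =1 g.
Proof.
move=> /ltn_incr fm /ltn_incr gm fg gf n.
elim/ltn_ind: n => n IH.
have [j fj] := fg n; have [k gk] := gf n.
have nj : n <= j.
  rewrite leqNgt; apply/negP => jn.
  by have := fm j n; rewrite jn (IH j jn) fj ltnn.
have nk : n <= k.
  rewrite leqNgt; apply/negP => kn.
  by have := gm k n; rewrite kn -(IH k kn) gk ltnn.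
have := gm j n; have := fm k n; rewrite -fj -gk; lia.
Qed.

Lemma incr_bracket (f : nat -> nat) k :
  (forall i, f i < f i.+1) -> f 0 <= k -> exists n, f n <= k < f n.+1.
Proof.
move=> fS; elim: k => [|k IH] f0; first by exists 0; have := fS 0; lia.
case: (leqP (f 0) k) => [/IH [n nk]|]; last by exists 0; have := fS 0; lia.
case: (ltnP k.+1 (f n.+1)) => h; first by exists n; lia.
by exists n.+1; have := fS n.+1; lia.
Qed.

Definition complementary (f g : nat -> nat) : Prop :=
  [/\ forall n, 0 < f n /\ 0 < g n,
      forall k, 0 < k -> exists n, k = f n \/ k = g n
    & forall n m, f n <> g m].

(** * Letter counts in infinite words *)

Definition prefix_count (T : eqType) (w : nat -> T) (x : T) (n : nat) :=
  count_mem x (mkseq w n).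

Lemma prefix_countS (T : eqType) (w : nat -> T) x n :
  prefix_count w x n.+1 = prefix_count w x n + (w n == x).
Proof. by rewrite /prefix_count mkseqS -cats1 count_cat /= addn0. Qed.

Lemma prefix_count_mono (T : eqType) (w : nat -> T) x :
  {homo prefix_count w x : m n / m <= n}.
Proof.
by apply: homo_leq => // [m n p|n]; [exact: leq_trans|rewrite prefix_countS leq_addr].
Qed.

Lemma prefix_count_inj (T : eqType) (w : nat -> T) x m n :
  w m = x -> w n = x -> prefix_count w x m = prefix_count w x n -> m = n.
Proof.
move=> wm wn e; have Sm := prefix_countS w x m; have Sn := prefix_countS w x n.
rewrite wm eqxx in Sm; rewrite wn eqxx in Sn.
case: (ltngtP m n) => // /(@prefix_count_mono _ w x); lia.
Qed.

(* Write the positions from 1 and replace each letter of w by a block, of length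
   2 for x and 1 otherwise: the first sequence lists the first places of the
   blocks and the second one the second places. *)
Lemma complementary_blocks (T : eqType) (w : nat -> T) (x : T) (X : nat -> nat) :
  (forall m, w (X m) = x) -> (forall m, prefix_count w x (X m) = m) ->
  complementary (fun n => n + 1 + prefix_count w x n) (fun m => X m + m + 2).
Proof.
move=> wX cX; pose g n := n + 1 + prefix_count w x n.
have gS n : g n.+1 = g n + 1 + (w n == x) by rewrite /g prefix_countS; lia.
have gi n : g n < g n.+1 by rewrite gS; lia.
split=> [n|k k0|n m]; first by lia.
(* [g n] is the first place of block [n], so [k] lies in some block. *)
- have [|n] := @incr_bracket g k gi; first by rewrite /g /prefix_count /=; lia.
  rewrite gS; case: eqP => [wn nk|_ nk]; last by exists n; left; rewrite /g in nk *; lia.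
  case: (eqVneq k (g n)) => [->|ne]; first by exists n; left.
  exists (prefix_count w x n); right.
  rewrite (@prefix_count_inj _ w x (X _) n) //; move: nk ne; rewrite /g; lia.
(* [g n] would fall strictly between two consecutive values of [g]. *)
- move=> e; have e1 : g n = g (X m) + 1 by rewrite /g cX; lia.
  have h1 : X m < n by rewrite -(ltn_incr gi); lia.
  have h2 : n < (X m).+1 by rewrite -(ltn_incr gi) gS wX eqxx; lia.
  lia.
Qed.

(** * Deleting a letter *)

(** Both sides are images under [w] of strictly increasing index lists with the same members. *)
Lemma deletion_prefix (T : eqType) (x : T) (w v : nat -> T) (f : nat -> nat) i :
  (forall i, f i < f i.+1) -> (forall j, w j <> x <-> exists i, f i = j) ->
  (forall i, v i = w (f i)) ->
  mkseq v i = [seq y <- mkseq w (f i) | y != x].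
Proof.
move=> fS fP vE; have fm := ltn_incr fS.
rewrite /mkseq filter_map (eq_map vE) (map_comp w f); congr map.
apply: (irr_sorted_eq ltn_trans ltnn) => [||j].
- rewrite sorted_map; apply: sub_sorted (iota_ltn_sorted 0 i) => m n.
  by rewrite /= fm.
- exact/(sorted_filter ltn_trans)/iota_ltn_sorted.
- rewrite mem_filter mem_iota /=; apply/mapP/andP => [[k]|[/eqP wj jf]].
    rewrite mem_iota /= add0n => ki ->; rewrite add0n fm; split=> //.
    by apply/eqP/fP; exists k.
  have /fP [k fk] := wj; exists k => //.
  by rewrite mem_iota /= add0n -fm fk.
Qed.

(** Deletion moves place [j] left by the number of letters [x] before it and keeps the count of [y];
    the successors convert to counting from 1. *)
Lemma deletion_occurrence (T : eqType) (x y : T) (w v : nat -> T) (n j : nat) :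
  deletion x w v -> y != x -> w j = y -> prefix_count w y j = n ->
  nth_occurrence v y n.+1 (j - prefix_count w x j).+1.
Proof.
move=> [f [fS fP vE]] yx wj cj.
have /fP [i fi] : w j <> x by rewrite wj; apply/eqP.
have pre := deletion_prefix i fS fP vE; rewrite fi in pre.
have -> : j - prefix_count w x j = i.
  rewrite -[in RHS](size_mkseq v i) pre size_filter -{1}(size_mkseq w j).
  by rewrite /prefix_count -(count_predC (pred1 x) (mkseq w j)) addKn.
rewrite /nth_occurrence -/(prefix_count v y i.+1) prefix_countS /= vE fi wj eqxx /=.
rewrite /prefix_count pre count_filter addn1 eqSS -cj; apply/eqP/eq_count => z /=.
by case: eqP => // ->.
Qed.

(** * The Tribonacci word *)

Lemma word_limit_prefix (T : Type) (w : nat -> seq T) (t : nat -> T) n :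
  word_limit w t -> exists M, forall m, M <= m -> take n (w m) = mkseq t n.
Proof.
move=> lim; elim: n => [|n [M HM]]; first by exists 0 => m _; rewrite take0.
have [M' HM'] := lim n; exists (maxn M M') => m; rewrite geq_max => /andP[h h'].
have := HM' m h'; have := HM m h; rewrite mkseqS => <-.
case: (ltnP n (size (w m))) => [lt|le]; last by rewrite onthE nth_default ?size_map.
by rewrite onthE (nth_map (t n)) // (take_nth (t n)) // => -[->].
Qed.

(* The block tau (t n) of t = tau(t) starts here, which is also the place of the
   n-th a, counting from 0. *)
Definition tau_pos (t : nat -> letter) n := size (tau_word (mkseq t n)).

Lemma tau_word_cat s1 s2 : tau_word (s1 ++ s2) = tau_word s1 ++ tau_word s2.
Proof. by rewrite /tau_word map_cat flatten_cat. Qed.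

(** A late iterate begins with [mkseq t n], so the next one begins with its image under [tau_word],
    and it also agrees with [t] on that length. *)
Lemma tribonacci_fixed t n :
  tribonacci_word t -> tau_word (mkseq t n) = mkseq t (tau_pos t n).
Proof.
move=> ht; have [M HM] := word_limit_prefix n ht.
have [M' HM'] := word_limit_prefix (tau_pos t n) ht.
rewrite -(HM' (maxn M M').+1) ?leqW ?leq_maxr //= -[in RHS](cat_take_drop n (iter _ _ _)).
by rewrite (HM _ (leq_maxl _ _)) tau_word_cat take_size_cat.
Qed.

Lemma prefix_count_letters t n :
  prefix_count t La n + prefix_count t Lb n + prefix_count t Lc n = n.
Proof. by elim: n => // n IH; rewrite !prefix_countS; case: (t n) => /=; lia. Qed.

(** Each [tau x] contains exactly one [La], while [Lb] occurs only in [tau La] and [Lc] only in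
    [tau Lb], once each. *)
Lemma tau_pos_counts t n : tribonacci_word t ->
  [/\ prefix_count t La (tau_pos t n) = n,
      prefix_count t Lb (tau_pos t n) = prefix_count t La n
    & prefix_count t Lc (tau_pos t n) = prefix_count t Lb n].
Proof.
move=> ht; rewrite /prefix_count -!(tribonacci_fixed _ ht).
elim: n => // n; rewrite mkseqS -cats1 tau_word_cat !count_cat => -[-> -> ->].
by case: (t n) => /=; split; lia.
Qed.

Lemma tau_posE t n : tribonacci_word t ->
  tau_pos t n = n + prefix_count t La n + prefix_count t Lb n.
Proof.
move=> ht; rewrite -{1}(prefix_count_letters t (tau_pos t n)).
by have [-> -> ->] := tau_pos_counts n ht.
Qed.

Lemma tau_pos_letters t n k : tribonacci_word t -> k < size (tau (t n)) ->
  t (tau_pos t n + k) = nth La (tau (t n)) k.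
Proof.
move=> ht kn; have := tribonacci_fixed n.+1 ht; have := tribonacci_fixed n ht.
rewrite /tau_pos mkseqS -cats1 tau_word_cat => e /(congr1 (nth La ^~ (tau_pos t n + k))).
rewrite /tau_pos nth_cat ltnNge leq_addr addKn /tau_word /= cats0 => ->.
by rewrite nth_mkseq // size_cat ltn_add2l.
Qed.

Lemma tau_pos_a t n : tribonacci_word t -> t (tau_pos t n) = La.
Proof.
by move=> ht; rewrite -[tau_pos t n]addn0 tau_pos_letters //; case: (t n).
Qed.

(** Counting from 0, the [n]-th [Lb] is the second letter of the block of the [n]-th [La]; likewise
    for [Lc] and [Lb]. *)
Definition b_pos t n := (tau_pos t (tau_pos t n)).+1.
Definition c_pos t n := (tau_pos t (b_pos t n)).+1.

Lemma b_pos_letter t n : tribonacci_word t -> t (b_pos t n) = Lb.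
Proof.
by move=> ht; rewrite /b_pos -addn1 tau_pos_letters // tau_pos_a.
Qed.

Lemma c_pos_letter t n : tribonacci_word t -> t (c_pos t n) = Lc.
Proof.
by move=> ht; rewrite /c_pos -addn1 tau_pos_letters // b_pos_letter.
Qed.

Lemma b_pos_counts t n : tribonacci_word t ->
  prefix_count t La (b_pos t n) = (tau_pos t n).+1 /\
  prefix_count t Lb (b_pos t n) = n.
Proof.
move=> ht; rewrite !prefix_countS tau_pos_a //=.
have [-> -> _] := tau_pos_counts (tau_pos t n) ht.
by have [-> _ _] := tau_pos_counts n ht; lia.
Qed.

Lemma c_pos_counts t n : tribonacci_word t ->
  prefix_count t Lb (c_pos t n) = (tau_pos t n).+1 /\
  prefix_count t Lc (c_pos t n) = n.
Proof.
move=> ht; rewrite !prefix_countS tau_pos_a //=.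
have [_ -> ->] := tau_pos_counts (b_pos t n) ht.
by have [-> ->] := b_pos_counts n ht; lia.
Qed.

Lemma b_posE t n : tribonacci_word t ->
  b_pos t n = n.*2 + (prefix_count t La n).*2 + prefix_count t Lb n + 1.
Proof.
move=> ht; rewrite /b_pos (tau_posE (tau_pos t n) ht) {1}(tau_posE n ht).
by have [-> -> _] := tau_pos_counts n ht; lia.
Qed.

(** * The game *)

Lemma dee_move_swap x y u v : dee_move (x, y) (u, v) -> dee_move (y, x) (v, u).
Proof.
move=> [ne m]; split; first by move=> [e1 e2]; apply: ne; rewrite e1 e2.
case: m => [[x' h [-> ->]]|[y' h [-> ->]]|[p [q [st sl]]]].
- by apply: Or32; exists x'.
- by apply: Or31; exists y'.
apply: Or33; exists q, p; split.
  by case: st => [[-> ->]|[h [-> ->]]|[h [-> ->]]]; [apply: Or31|apply: Or33|apply: Or32].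
case: sl => [[s h [-> ->]]|[h [s hs [-> ->]]]|[h [s hs [-> ->]]]].
- by apply: Or31; exists s; rewrite // minnC.
- by apply: Or33; split=> //; exists s.
- by apply: Or32; split=> //; exists s.
Qed.

Definition paired (a b : nat -> nat) (p : position) : Prop :=
  [\/ p = (0, 0), exists n, p = (a n, b n) | exists n, p = (b n, a n)].

Lemma paired_swap a b x y : paired a b (x, y) -> paired a b (y, x).
Proof.
case=> [[-> ->]|[n [-> ->]]|[n [-> ->]]]; first exact: Or31.
- by apply: Or33; exists n.
- by apply: Or32; exists n.
Qed.

Section Pairs.

Variables a e : nat -> nat.
Hypothesis a_incr : forall n, a n < a n.+1.
Hypothesis e_incr : forall n, e n < e n.+1.
Let b n := a n + (e n).*2.
Hypothesis ab_compl : complementary a b.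
Hypothesis ef_compl : complementary e (fun n => a n + e n).

Lemma paired_no_move n q : dee_move (a n, b n) q -> ~ paired a b q.
Proof.
have b_inj i j : b i = b j -> i = j.
  have bm k : b k < b k.+1 by rewrite /b; have := a_incr k; have := e_incr k; lia.
  exact: (incr_inj bm).
have [ab0 _ abN] := ab_compl; have [e0 _ efN] := ef_compl.
have [[an bn] [en fn]] := (ab0 n, e0 n).
move=> [ne [[x' h qE]|[y' h qE]|[u [v [st sl]]]]].
- rewrite {}qE; case=> [[_]|[m [xm /b_inj nm]]|[m [_ /esym/abN]]] //; first by lia.
  by subst; rewrite ltnn in h.
- rewrite {}qE; case=> [[an0 _]|[m [/(incr_inj a_incr) nm ym]]|[m [/abN]]] //; first by lia.
  by subst; rewrite ltnn in h.
have uv : u < v /\ (e n).*2 - 1 <= v - u <= (e n).*2 + 1.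
  by move: st; rewrite /b; case=> [[-> ->]|[h [-> ->]]|[h [-> ->]]]; lia.
case: sl => [[s hs qE]|[h [s hs qE]]|[h]]; last by lia.
- rewrite {}qE in ne *; case=> [[]|[m [um vm]]|[m [um vm]]].
  + by lia.
  (* [v - u] equals [(e m).*2] and is within 1 of [(e n).*2], so parity gives [e m = e n]. *)
  + have nm : m = n by apply: (incr_inj e_incr); move: vm; rewrite /b; lia.
    by apply: ne; rewrite um vm nm.
  + by move: um; rewrite /b; lia.
- rewrite {}qE in ne *; case=> [[]|[m [um vm]]|[m [um vm]]]; first by lia.
  (* The coordinate sum is [(a m + e m).*2], so parity would give [e n = a m + e m]. *)
  + by apply: (efN n m); move: vm; rewrite /b; lia.
  + by apply: (efN n m); move: um; rewrite /b; lia.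
Qed.

Lemma paired_or_move x y : x <= y ->
  paired a b (x, y) \/ exists2 q, dee_move (x, y) q & paired a b q.
Proof.
have [ab0 abT _] := ab_compl; have [e0 efT _] := ef_compl.
move=> xy; case: (posnP x) => [x0|x0].
  case: (eqVneq (x, y) (0, 0)) => [->|/eqP ne]; first by left; apply: Or31.
  right; exists (0, 0); last exact: Or31.
  by apply: dee_move_axis; [left|].
have [n [xn|xn]] := abT x x0; last first.
  right; exists (x, a n); last by apply: Or33; exists n; rewrite xn.
  have lt : a n < y by have := e0 n; move: xn; rewrite /b; lia.
  by split; [case; lia|apply: Or32; exists (a n)].
subst x; case: (ltngtP (b n) y) => [lt|gt|eq]; last first.
- by left; apply: Or32; exists n; rewrite eq.
- pose j := (y - a n)./2; pose v := a n + j.*2.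
  (* Starting one place lower makes an odd difference even. *)
  have st : dee_start (a n) y (a n) v.
    have [->|vy] : v = y \/ v = y.-1 /\ 0 < y by rewrite /v /j; lia.
      exact: Or31.
    by case: vy => -> y0; apply: Or33.
  have je : j < e n by move: gt; rewrite /b /j; lia.
  suff [q [sl qp]] : exists q, dee_slide (a n) v q /\ paired a b q.
    (* A slide ending at the position itself is no move, but shows it to be paired. *)
    case: (eqVneq q (a n, y)) => [<-|/eqP ne]; first by left.
    by right; exists q => //; split; last by apply: Or33; exists (a n), v.
  (* The even number [j.*2] is 0, the difference of a pair, or the sum of a pair: slide diagonally
     to the origin or to the pair, or along the antidiagonal to the pair. *)
  case: (posnP j) => [j0|/efT [m [jm|jm]]].
  + exists (0, 0); split; last exact: Or31.
    by apply: Or31; exists (a n); [|congr pair]; rewrite /v; lia.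
  + exists (a m, b m); split; last by apply: Or32; exists m.
    have mn : m < n by rewrite -(ltn_incr e_incr) -jm.
    have amn : a m < a n by rewrite (ltn_incr a_incr).
    by apply: Or31; exists (a n - a m); [|congr pair]; rewrite /v /b; lia.
  + exists (a m, b m); split; last by apply: Or32; exists m.
    have := ab0 m; have := e0 m => e0m ab0m.
    apply: Or32; split; first by rewrite /v; lia.
    by exists (a m); [|congr pair]; rewrite /v /b; lia.
- right; exists (a n, b n); last by apply: Or32; exists n.
  by split; [case; lia|apply: Or32; exists (b n)].
Qed.

Lemma P_positions_paired : P_positions (paired a b).
Proof.
split=> [|[x y]]; first exact: Or31.
split=> [xy [q mq qp]|nomove].
  case: xy mq => [[-> ->]|[n [-> ->]]|[n [-> ->]]]; first exact: dee_no_move.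
    by move=> /paired_no_move; apply.
  by case: q qp => u v /paired_swap qp /dee_move_swap /paired_no_move; apply.
case: (leqP x y) => [/paired_or_move [//|]|/ltnW/paired_or_move []].
- by move/nomove.
- exact: paired_swap.
- case=> -[u v] m p; case: nomove.
  by exists (v, u); [apply: dee_move_swap|apply: paired_swap].
Qed.

End Pairs.

(** * Uniqueness of the ordered list, and the conclusion *)

Lemma lists_P_eq P a b a' b' : lists_P P a b -> lists_P P a' b' ->
  forall n, 0 < n -> a n = a' n /\ b n = b' n.
Proof.
move=> [ai aP] [ai' aP'].
have tr c d c' d' : (forall x y, (0 < x <= y /\ P (x, y)) <->
      exists2 n, 0 < n & (x, y) = (c n, d n)) ->
    (forall x y, (0 < x <= y /\ P (x, y)) <->
      exists2 n, 0 < n & (x, y) = (c' n, d' n)) ->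
    forall n, exists m, c n.+1 = c' m.+1 /\ d n.+1 = d' m.+1.
  move=> H H' n; have /H /H' [[//|m] _ [-> ->]] : exists2 k, 0 < k &
    (c n.+1, d n.+1) = (c k, d k) by exists n.+1.
  by exists m.
have aS n : a n.+1 < a n.+2 by apply: ai.
have aS' n : a' n.+1 < a' n.+2 by apply: ai'.
have E : a \o succn =1 a' \o succn.
  apply: incr_same_range_eq => // n.
  - by have [m [h _]] := tr _ _ _ _ aP aP' n; exists m.
  - by have [m [h _]] := tr _ _ _ _ aP' aP n; exists m.
move=> [//|n] _; split; first exact: E.
have [m [h ->]] := tr _ _ _ _ aP aP' n.
by have <- : n = m by apply: (incr_inj aS'); rewrite -h; symmetry; exact: E.
Qed.

Theorem theorem2 (P : position -> Prop) (t tb : nat -> letter)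
    (hP : P_positions P) (ht : tribonacci_word t) (htb : deletion Lb t tb) :
  (exists a b : nat -> nat, lists_P P a b) /\
  (forall a b : nat -> nat, lists_P P a b ->
     forall n : nat, 0 < n ->
       nth_occurrence tb La n (a n) /\ nth_occurrence tb Lc n (b n)).
Proof.
pose a n := n + 1 + prefix_count t Lb n.
pose e n := n + 1 + prefix_count t La n.
pose b n := a n + (e n).*2.
have aS n : a n < a n.+1 by rewrite /a prefix_countS; lia.
have eS n : e n < e n.+1 by rewrite /e prefix_countS; lia.
have compl_ext f g g' : g =1 g' -> complementary f g -> complementary f g'.
  by move=> gg [h0 h1 h2]; split=> [n|k /h1 [n]|n m]; [|exists n|]; rewrite -gg.
(* Doubling [Lb] puts the second places at [b_pos t m + m + 2 = b m]; doubling [La] below puts them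
   at [tau_pos t m + m + 2 = a m + e m]. *)
have ab : complementary a b.
  apply: compl_ext _ _ _ _ (@complementary_blocks _ t Lb (b_pos t)
    (fun m => b_pos_letter m ht) _) => m.
    by rewrite b_posE // /b /a /e; lia.
  by have [] := b_pos_counts m ht.
have ef : complementary e (fun n => a n + e n).
  apply: compl_ext _ _ _ _ (@complementary_blocks _ t La (tau_pos t)
    (fun m => tau_pos_a m ht) _) => m.
    by rewrite tau_posE // /a /e; lia.
  by have [] := tau_pos_counts m ht.
have PE := P_positions_unique hP (P_positions_paired aS eS ab ef).
(* The list starts at index 1, the explicit sequences at 0. *)
have L : lists_P P (fun n => a n.-1) (fun n => b n.-1).
  split=> [[//|n] _|x y]; first exact: aS.
  split=> [[xy /PE []]|[[//|n] _ /= [-> ->]]].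
  - by case=> x0 y0; move: xy; rewrite x0.
  - by move=> [n xyE]; exists n.+1.
  - by move=> [n [xb ya]]; move: xy; rewrite xb ya /b /e; lia.
  - by split; [rewrite /b /a; lia|apply/PE; apply: Or32; exists n].
split=> [|a' b' L' [//|n] n0]; first by exists (fun n => a n.-1), (fun n => b n.-1).
have [-> ->] := lists_P_eq L' L n0; rewrite /=; split.
- have [ca cb _] := tau_pos_counts n ht.
  have := deletion_occurrence (y := La) htb isT (tau_pos_a n ht) ca.
  by rewrite cb tau_posE //; congr nth_occurrence; rewrite /a; lia.
(* Deleting the [tau_pos t n + 1] letters [Lb] before this [Lc] leaves it at place
   [b_pos t n + n + 2 = b n]. *)
- have [cb cc] := c_pos_counts n ht.
  have := deletion_occurrence (y := Lc) htb isT (c_pos_letter n ht) cc.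
  rewrite cb /c_pos (tau_posE (b_pos t n)) //.
  have [-> ->] := b_pos_counts n ht.
  rewrite b_posE // tau_posE //; congr nth_occurrence; rewrite /b /a /e; lia.
Qed.
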